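(* Let $G$ be a connected bipartite graph. (i) If $\delta(G)<\Delta(G)\le 3$, then $\operatorname{reg}(G)\le 2\operatorname{im}(G)$. (ii) If $G$ is $3$-regular, then $\operatorname{reg}(G)\le 2\operatorname{im}(G)+1$.
   Context: $\delta(G),\Delta(G)$ are the minimum and maximum degree. $\operatorname{reg}(G)=\max\{j\ge0:\widetilde H_{j-1}(\operatorname{Ind}(G[S]);\Bbbk)\neq0\text{ for some }S\subseteq V(G)\}$ over a field $\Bbbk$ ($\operatorname{Ind}$ = independence complex). $\operatorname{im}(G)$ is the induced matching number. *)

(* Defs.v *)
From HB Require Import structures.
From mathcomp Require Import all_boot all_order all_algebra.
Set Implicit Arguments. Unset Strict Implicit. Unset Printing Implicit Defensive.
Import GRing.Theory.

Section Graphs.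
Variable T : finType.

Definition simple_graph (e : rel T) : Prop := symmetric e /\ irreflexive e.

Definition connected (e : rel T) : Prop := forall x y : T, connect e x y.

Definition bipartite (e : rel T) : Prop :=
  exists f : T -> bool, forall x y, e x y -> f x != f y.

Definition deg (e : rel T) (x : T) : nat := #|[set y | e x y]|.

Definition maxdeg (e : rel T) : nat := \max_(x : T) deg e x.
(* delta(G); every degree is < #|T|, so #|T| is a neutral start value *)
Definition mindeg (e : rel T) : nat := \big[minn/#|T|]_(x : T) deg e x.

Definition regular (e : rel T) (d : nat) : Prop := forall x, deg e x = d.

Definition is_edge (e : rel T) (A : {set T}) : bool :=
  [exists x, exists y, e x y && (A == [set x; y])].

Definition induced_matching (e : rel T) (M : {set {set T}}) : bool :=
  [forall A in M, is_edge e A] &&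
  [forall A in M, forall B in M, (A != B) ==>
     [forall x in A, forall y in B, (x != y) && ~~ e x y]].

Definition im (e : rel T) : nat :=
  \max_(M : {set {set T}} | induced_matching e M) #|M|.

Definition indep_face (e : rel T) (S s : {set T}) : bool :=
  (s \subset S) && [forall x in s, forall y in s, ~~ e x y].

Definition NS := #|{: {set T}}|.
Definition sv (i : 'I_NS) : {set T} := enum_val i.

Definition sgn (F : fieldType) (s : {set T}) (v : T) : F :=
  ((-1) ^+ #|[set u in s | (enum_rank u < enum_rank v)%N]|)%R.

(* Simplicial boundary map on chains of faces with m vertices (dimension m-1)
   of Ind(G[S]), as an NS x NS matrix acting on row vectors indexed by all
   subsets of T (rows/columns of non-faces / wrong sizes are zero). *)
Definition bd (F : fieldType) (e : rel T) (S : {set T}) (m : nat)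
  : 'M[F]_(NS, NS) :=
  \matrix_(i, j)
    (if indep_face e S (sv i) && (#|sv i| == m)
     then \sum_(v in sv i | sv j == sv i :\ v) sgn F (sv i) v else 0)%R.

(* projector onto the chain group C_{m-1}: faces with m vertices *)
Definition chains (F : fieldType) (e : rel T) (S : {set T}) (m : nat)
  : 'M[F]_(NS, NS) :=
  \matrix_(i, j)
    (if (i == j) && indep_face e S (sv i) && (#|sv i| == m) then 1 else 0)%R.

(* reduced homology \tilde H_{m-1}(Ind(G[S]); F) is nonzero, i.e.
   ker d_m (on C_{m-1}) is not contained in im d_{m+1}. *)
Definition redH_nonzero (F : fieldType) (e : rel T) (S : {set T}) (m : nat)
  : bool :=
  ~~ ((chains F e S m :&: kermx (bd F e S m)) <= bd F e S m.+1)%MS.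

(* reg(G) = max { j : \tilde H_{j-1}(Ind(G[S])) <> 0 for some S };
   such j satisfies j <= #|S| as there are no faces with more vertices. *)
Definition reg (F : fieldType) (e : rel T) : nat :=
  \max_(S : {set T}) \max_(j < #|S|.+1 | redH_nonzero F e S j) j.

End Graphs.

(* Main.v *)
Require Import Defs.
From HB Require Import structures.
From mathcomp Require Import all_boot all_order all_algebra.

(** Bipartiteness plays no role: if G is k-degenerate (every nonempty induced
subgraph has a vertex of degree at most k) then reg G <= k im G.  Homology of
Ind G in degree m survives either in G - v, in degree m, or in G - N[v], in
degree m - 1.  Let x have degree at most k and let y be a neighbour of x.  In
the first case for v = y, conclude by induction.  In the second case, treating
the at most k - 1 remaining neighbours of x in turn reaches an induced subgraph
of G - N[x] - N[y] after losing at most k degrees in total, and the edge xy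
extends every induced matching of that subgraph; x cannot be isolated, as
Ind G would be a cone.  A proper induced subgraph of a connected graph of maximum
degree at most 3 is 2-degenerate, since some edge leaves every proper nonempty
set of vertices.  In the 3-regular case, deleting one vertex costs one degree. *)

Set Implicit Arguments.
Unset Strict Implicit.
Unset Printing Implicit Defensive.

Import GRing.Theory.

(** * Reduced chains of the independence complex, as functions on vertex sets *)

Section Homology.
Variables (F : fieldType) (T : finType) (e : rel T).
Implicit Types (S U s t : {set T}) (u v x y : T) (c d : {set T} -> F) (m : nat).

Local Open Scope ring_scope.

Definition boundary c s : F :=
  \sum_(u | u \notin s) sgn F (u |: s) u * c (u |: s).

(** Linear extension of adding [v] to a face, faces through [v] going to 0; the sign gives the
    original face coefficient 1 in the boundary of its image. *)
Definition cone v c s : F := if v \in s then sgn F s v * c (s :\ v) else 0.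

(* Chains of faces with [m] vertices, i.e. of dimension [m - 1]. *)
Definition chain S m c : Prop :=
  forall s, c s != 0 -> indep_face e S s && (#|s| == m).

(** Vanishing of reduced homology in dimension [m - 1]; the empty face supplies the augmentation. *)
Definition acyclic S m : Prop :=
  forall c, chain S m c -> boundary c =1 (fun=> 0) ->
  exists2 d, chain S m.+1 d & boundary d =1 c.

Lemma indep_faceP S s :
  reflect (s \subset S /\ {in s &, forall x y, ~~ e x y}) (indep_face e S s).
Proof.
apply: (iffP andP) => -[sS H]; split=> //.
  by move=> x y xs ys; move/forall_inP: H => /(_ x xs)/forall_inP/(_ y ys).
by apply/forall_inP => x xs; apply/forall_inP => y ys; apply: H.
Qed.

Lemma chain0 S m c s : chain S m c -> ~~ (indep_face e S s && (#|s| == m)) ->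
  c s = 0.
Proof. by move=> cP; apply: contraNeq => /cP. Qed.

Lemma eq_boundary c d : c =1 d -> boundary c =1 boundary d.
Proof. by move=> cd s; apply: eq_bigr => u _; rewrite cd. Qed.

Lemma boundaryD c d s :
  boundary (fun t => c t + d t) s = boundary c s + boundary d s.
Proof. by rewrite -big_split; apply: eq_bigr => u _; rewrite mulrDr. Qed.

Lemma boundaryN c s : boundary (fun t => - c t) s = - boundary c s.
Proof. by rewrite -sumrN; apply: eq_bigr => u _; rewrite mulrN. Qed.

Lemma boundary_off v c : (forall s, v \in s -> c s = 0) ->
  forall s, v \in s -> boundary c s = 0.
Proof.
by move=> c0 s vs; apply: big1 => u _; rewrite c0 ?mulr0 // setU1r.
Qed.

Lemma sgn_setU1 s u v : u \notin s ->
  sgn F (u |: s) v = (-1) ^+ (enum_rank u < enum_rank v)%N * sgn F s v.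
Proof.
move=> us; rewrite /sgn -exprD; congr (_ ^+ _).
rewrite -!sum1dep_card !big_mkcondr /= big_setU1 //=.
Qed.

Lemma sgn_sqr s v : sgn F s v * sgn F s v = 1.
Proof. by rewrite /sgn -expr2 sqrr_sign. Qed.

(** Exactly one of [u], [v] precedes the other in the enumeration, so exactly one of the two signs
    flips. *)
Lemma sgn_swap t u v : u != v -> u \notin t -> v \notin t ->
  sgn F (u |: (v |: t)) u * sgn F (u |: (v |: t)) v =
  - (sgn F (v |: t) v * sgn F (u |: t) u).
Proof.
move=> uv ut vt.
have uvt : u \notin v |: t by rewrite in_setU1 negb_or uv.
rewrite !(sgn_setU1 _ uvt) !(sgn_setU1 _ vt) !(sgn_setU1 _ ut) !ltnn !mul1r.
have : nat_of_ord (enum_rank u) != enum_rank v.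
  by apply: contraNneq uv => /ord_inj/enum_rank_inj ->.
by case: ltngtP => //= _ _; rewrite ?expr0 ?expr1 ?mul1r ?mulN1r ?mulNr ?mulrN
  mulrC.
Qed.

(* The full simplex on [T] is contractible: [c] need not be supported on faces. *)
Lemma cone_homotopy v c s :
  boundary (cone v c) s + cone v (boundary c) s = c s.
Proof.
have [vs|vs] := boolP (v \in s); last first.
  rewrite {2}/cone (negPf vs) addr0 /boundary (bigD1 v) //= big1 => [|u].
    by rewrite addr0 /cone setU11 mulrA sgn_sqr mul1r setU1K.
  move=> /andP[us uv]; rewrite /cone in_setU1 eq_sym (negPf uv) (negPf vs).
  by rewrite mulr0.
have vt : v \notin s :\ v by rewrite setD11.
rewrite {2}/cone vs -[in LHS](setD1K vs) setU1K //.
rewrite -[in RHS](setD1K vs); move: (s :\ v) vt => {vs} {}s vs.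
(* The summand at [v] already yields [c (v |: s)]; the others cancel termwise against
   [boundary (cone v c)]. *)
rewrite {2}/boundary (bigD1 v) //= mulrDr mulrA sgn_sqr mul1r addrCA.
rewrite -[RHS]addr0; congr (_ + _).
rewrite mulr_sumr /boundary.
rewrite [X in X + _](eq_bigl (fun u => (u \notin s) && (u != v))); last first.
  by move=> u; rewrite in_setU1 negb_or andbC.
rewrite -big_split big1 //= => u; move=> /andP[us uv].
have -> : cone v c (u |: (v |: s)) = sgn F (u |: (v |: s)) v * c (u |: s).
  by rewrite /cone !inE eqxx orbT setUCA setU1K // !inE negb_or eq_sym uv.
by rewrite !mulrA sgn_swap // mulNr addNr.
Qed.

(** * Comparison with the matrix form of homology *)

(** Rows of [bd] sum over the vertex removed, [boundary] over the vertex added; exchanging sums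
    matches them. Rows off the chain group vanish, hence the truncation of [w]. *)
Lemma mul_bd S m (w : 'rV_(NS T)) j :
  (w *m bd F e S m) 0 j =
  boundary (fun s => if indep_face e S s && (#|s| == m)
                     then w 0 (enum_rank s) else 0) (sv j).
Proof.
rewrite mxE (reindex (@enum_rank {set T})) /=; last first.
  by exists enum_val => i _; rewrite ?enum_rankK ?enum_valK.
set t := sv j.
under eq_bigr => s _ do rewrite mxE /sv enum_rankK -/(sv j) -/t.
pose g s := if indep_face e S s && (#|s| == m) then w 0 (enum_rank s) else 0.
have gE s : w 0 (enum_rank s) *
    (if indep_face e S s && (#|s| == m)
     then \sum_(v in s | t == s :\ v) sgn F s v else 0) =
    \sum_(v in s | t == s :\ v) sgn F s v * g s.
  rewrite -mulr_suml mulrC /g; case: ifP => _ //.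
  by rewrite mul0r mulr0.
under eq_bigr do rewrite gE.
rewrite (exchange_big_dep predT) //= /boundary [RHS]big_mkcond.
apply: eq_bigr => v _; case: ifPn => [vt|].
  rewrite (big_pred1 (v |: t)) // => s; apply/andP/eqP => [[vs /eqP->]|->].
    by rewrite setD1K.
  by rewrite setU11 setU1K.
rewrite negbK => vt; apply: big1 => s /andP[_ /eqP ts].
by move: vt; rewrite ts setD11.
Qed.

Lemma mul_chains S m (w : 'rV_(NS T)) j :
  (w *m chains F e S m) 0 j =
  if indep_face e S (sv j) && (#|sv j| == m) then w 0 j else 0.
Proof.
rewrite mxE (bigD1 j) //= big1 => [|i ij]; rewrite mxE.
  by rewrite eqxx addr0 /=; case: ifP; rewrite ?mulr1 ?mulr0.
by rewrite (negPf ij) mulr0.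
Qed.

Lemma chain_row S m c : chain S m c ->
  forall s, (if indep_face e S s && (#|s| == m)
             then (\row_i c (sv i)) 0 (enum_rank s) else 0) = c s.
Proof.
move=> cP s; rewrite mxE /sv enum_rankK; case: ifPn => // ns.
by rewrite (chain0 cP ns).
Qed.

Lemma acyclicP S m : reflect (acyclic S m) (~~ redH_nonzero F e S m).
Proof.
rewrite /redH_nonzero negbK; apply: (iffP idP) => [le c cP dc|ac].
  have : (\row_i c (sv i) <= chains F e S m :&: kermx (bd F e S m))%MS.
    rewrite sub_capmx; apply/andP; split; last first.
      apply/sub_kermxP/rowP => j; rewrite mul_bd (eq_boundary (chain_row cP)).
      by rewrite dc mxE.
    apply/submxP; exists (\row_i c (sv i)); apply/rowP => j.
    rewrite mul_chains mxE; case: ifPn => // ns.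
    by rewrite (chain0 cP ns).
  move=> /submx_trans/(_ le)/submxP[w wE].
  (* [w] need not be a chain; truncating it leaves its image under [bd] unchanged. *)
  exists (fun s => if indep_face e S s && (#|s| == m.+1)
                   then w 0 (enum_rank s) else 0) => s.
    by case: ifP => //; rewrite eqxx.
  by have := mul_bd S m.+1 w (enum_rank s); rewrite -wE mxE /sv enum_rankK.
apply/rV_subP => w; rewrite sub_capmx => /andP[/submxP[w' wE] /sub_kermxP w0].
pose c s := w 0 (enum_rank s).
have cP : chain S m c.
  move=> s; rewrite /c wE mul_chains /sv enum_rankK.
  by case: ifP => //; rewrite eqxx.
have cE s : (if indep_face e S s && (#|s| == m) then w 0 (enum_rank s) else 0)
    = c s.
  by case: ifPn => // ns; rewrite (chain0 cP ns).
have [s|d dP dE] := ac c cP.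
  have := mul_bd S m w (enum_rank s).
  by rewrite (eq_boundary cE) w0 mxE /sv enum_rankK.
apply/submxP; exists (\row_i d (sv i)); apply/rowP => j.
by rewrite mul_bd (eq_boundary (chain_row dP)) dE /c /sv enum_valK.
Qed.

(** * Cones, and the link and deletion of a vertex *)

Lemma chain_cone S U m v c : v \in S -> U \subset S -> {in U, forall u, ~~ e v u} ->
  symmetric e -> irreflexive e -> chain U m c -> chain S m.+1 (cone v c).
Proof.
move=> vS US nvU esym eirr cP s; rewrite /cone.
case: ifP => [vs|]; last by rewrite eqxx.
have [->|/cP] := eqVneq (c (s :\ v)) 0; first by rewrite mulr0 eqxx.
move=> /andP[/indep_faceP[sU is_] /eqP sm] _.
rewrite (cardsD1 v) vs sm eqxx andbT; apply/indep_faceP; split.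
  rewrite -(setD1K vs) subUset sub1set vS /=; exact: subset_trans US.
move=> x y; rewrite -{1 2}(setD1K vs) !in_setU1.
case/predU1P=> [->|xs]; case/predU1P=> [->|ys]; first by rewrite eirr.
- exact/nvU/(subsetP sU).
- by rewrite esym; exact/nvU/(subsetP sU).
- exact: is_.
Qed.

Lemma chain_sub S U m c : U \subset S -> chain U m c -> chain S m c.
Proof.
move=> US cP s /cP/andP[/indep_faceP[sU is_] ->]; rewrite andbT.
by apply/indep_faceP; split=> //; apply: subset_trans US.
Qed.

(** By [cone_homotopy], a cycle is the boundary of its own cone with apex [v]. *)
Lemma acyclic_isolated S m v : symmetric e -> irreflexive e -> v \in S ->
  {in S, forall u, ~~ e v u} -> acyclic S m.
Proof.
move=> esym eirr vS nv c cP dc; exists (cone v c); first exact: chain_cone cP.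
move=> s; rewrite -[RHS](cone_homotopy v) [X in _ + X]/cone dc mulr0.
by rewrite if_same addr0.
Qed.

(** Exactness at the middle term of the sequence from the homology of the deletion through that of
    the complex to that of the link, done on chains. *)
Lemma acyclic_link_deletion S m v : symmetric e -> irreflexive e -> v \in S ->
  acyclic (S :\ v) m.+1 -> acyclic (S :\ v :\: [set u | e v u]) m ->
  acyclic S m.+1.
Proof.
move=> esym eirr vS acD acL c cP dc.
have LS : S :\ v :\: [set u | e v u] \subset S.
  by apply: subset_trans (subsetDl _ _) (subsetDl _ _).
(* [b] is a cycle of the link of [v]; if [b] bounds [d] there, then
   [a + d = c + boundary (cone v d)] is a cycle avoiding [v]. *)
pose a s := if v \in s then 0 else c s.
pose b s := if v \in s then 0 else sgn F (v |: s) v * c (v |: s).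
have a0 s : v \in s -> a s = 0 by rewrite /a => ->.
have b0 s : v \in s -> b s = 0 by rewrite /b => ->.
have cE s : c s = a s + cone v b s.
  rewrite /a /cone /b; case: ifP => vs; last by rewrite addr0.
  by rewrite setD11 setD1K // mulrA sgn_sqr mul1r add0r.
have bP : chain (S :\ v :\: [set u | e v u]) m b.
  move=> s; rewrite /b; case: ifPn => [|vs]; first by rewrite eqxx.
  rewrite mulf_eq0 negb_or => /andP[_ /cP]; rewrite cardsU1 vs eqSS.
  move=> /andP[/indep_faceP[sS is_] ->]; rewrite andbT; apply/indep_faceP.
  split=> [|x y xs ys]; last by apply: is_; rewrite setU1r.
  apply/subsetP => x xs; rewrite !inE is_ ?setU11 ?setU1r //=.
  rewrite (subsetP sS) ?setU1r // andbT.
  by apply: contraNneq vs => <-.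
have dabE s : boundary a s + b s - cone v (boundary b) s = 0.
  by rewrite -[RHS](dc s) (eq_boundary cE) boundaryD -addrA
    -[X in X - _](cone_homotopy v) addrK.
have db : boundary b =1 fun=> 0.
  move=> s; have [vs|vs] := boolP (v \in s); first exact: boundary_off vs.
  (* On sets containing [v], both [boundary a] and [b] vanish, which isolates [boundary b]. *)
  have := dabE (v |: s); rewrite (boundary_off a0) ?b0 ?setU11 // !add0r.
  rewrite /cone setU11 setU1K // => /eqP; rewrite oppr_eq0 mulf_eq0.
  by rewrite signr_eq0 => /eqP.
have [d dP dE] := acL b bP db.
have dab s : boundary a s + b s = 0.
  by have := dabE s; rewrite /cone db mulr0 if_same subr0.
have d0 s : v \in s -> d s = 0.
  move=> vs; apply: chain0 dP _; apply: contraL vs => /andP[/indep_faceP[sL _] _].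
  by apply/negP => /(subsetP sL); rewrite !inE eqxx andbF.
have [s /=|s|h hP hE] := acD (fun s => a s + d s).
- have [vs|vs] := boolP (v \in s); first by rewrite a0 // d0 // addr0 eqxx.
  rewrite /a (negPf vs) => cd.
  have /andP[/indep_faceP[sS is_] ->] : indep_face e S s && (#|s| == m.+1).
    have [c0|/cP//] := eqVneq (c s) 0.
    by move: cd; rewrite c0 add0r => /(chain_sub LS dP).
  by rewrite andbT; apply/indep_faceP; rewrite subsetD1 sS vs.
- by rewrite boundaryD dE dab.
exists (fun s => h s - cone v d s) => [s|s].
  move=> hd; have [h0|/(chain_sub (subsetDl _ _) hP)//] := eqVneq (h s) 0.
  move: hd; rewrite h0 add0r oppr_eq0.
  apply: (chain_cone vS LS _ esym eirr dP).
  by move=> u; rewrite !inE => /andP[].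
rewrite boundaryD boundaryN hE cE -addrA; congr (_ + _).
rewrite -{1}[d s](cone_homotopy v) addrAC subrr add0r /cone.
by case: ifP => //; rewrite dE.
Qed.

End Homology.

(** * Induced matchings inside a vertex set *)

Section InducedMatchings.
Variables (T : finType) (e : rel T).
Implicit Types (S U : {set T}) (M : {set {set T}}) (x y : T).

(** The induced matching number of the subgraph induced on [S], computed with matchings of the whole
    graph: being induced depends only on the vertices covered. *)
Definition im_in S : nat :=
  \max_(M | induced_matching e M && (cover M \subset S)) #|M|.

Lemma im_in_max S M : induced_matching e M -> cover M \subset S ->
  #|M| <= im_in S.
Proof. by move=> iM cM; apply: leq_bigmax_cond; rewrite iM. Qed.

Lemma im_in_sub S U : U \subset S -> im_in U <= im_in S.
Proof.
move=> US; apply/bigmax_leqP => M /andP[iM cM].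
by apply: im_in_max => //; apply: subset_trans US.
Qed.

Lemma im_in_im S : im_in S <= im e.
Proof. by apply/bigmax_leqP => M /andP[iM _]; apply: leq_bigmax_cond. Qed.

Lemma induced_matchingP M :
  reflect ((forall A, A \in M -> is_edge e A) /\
           (forall A B, A \in M -> B \in M -> A != B ->
              {in A & B, forall x y, (x != y) && ~~ e x y}))
          (induced_matching e M).
Proof.
apply: (iffP andP) => -[eM dM]; split.
- by move=> A; move/forall_inP: eM; apply.
- move=> A B AM BM AB x y xA yB.
  move/forall_inP: dM => /(_ A AM)/forall_inP/(_ B BM)/implyP/(_ AB).
  by move=> /forall_inP/(_ x xA)/forall_inP/(_ y yB).
- exact/forall_inP.
apply/forall_inP => A AM; apply/forall_inP => B BM; apply/implyP => AB.
by apply/forall_inP => x xA; apply/forall_inP => y yB; apply: (dM A B).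
Qed.

Lemma im_in_edge S U x y : symmetric e -> x \in S -> y \in S -> e x y ->
  U \subset S ->
  {in U, forall u, [&& u != x, u != y, ~~ e x u & ~~ e y u]} ->
  im_in U < im_in S.
Proof.
move=> esym xS yS exy US Uxy; rewrite ltnNge; apply/negP => imS.
(* The empty matching makes the range nonempty, so the maximum is attained. *)
have M0 : induced_matching e set0 && (cover set0 \subset U).
  rewrite /cover big_set0 sub0set andbT.
  by apply/induced_matchingP; split=> [A|A B]; rewrite inE.
have [M /andP[/induced_matchingP[eM dM] cM] MU] :
    {M | induced_matching e M && (cover M \subset U) & im_in U = #|M|}.
  by apply: eq_bigmax_cond; apply/card_gt0P; exists set0.
have sU A u : A \in M -> u \in A -> u \in U.
  by move=> AM uA; apply: (subsetP cM); apply/bigcupP; exists A.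
have nM : [set x; y] \notin M.
  apply/negP => /sU/(_ (set21 x y))/Uxy; by rewrite eqxx.
have sep A : A \in M -> {in [set x; y] & A, forall u v, (u != v) && ~~ e u v}.
  move=> AM u v /set2P[]-> /(sU _ _ AM)/Uxy/and4P[vx vy xv yv].
    by rewrite eq_sym vx.
  by rewrite eq_sym vy.
suff : #|[set x; y] |: M| <= im_in S.
  by rewrite cardsU1 nM add1n -MU => /leq_trans/(_ imS); rewrite ltnn.
apply: im_in_max; last first.
  apply/subsetP => v /bigcupP[A /setU1P[->|AM] vA].
    by case/set2P: vA => ->.
  exact: subsetP US _ (sU _ _ AM vA).
apply/induced_matchingP; split=> [A /setU1P[->|/eM//]|A B].
  by apply/existsP; exists x; apply/existsP; exists y; rewrite exy eqxx.
case/setU1P=> [->|AM] /setU1P[->|BM]; first by rewrite eqxx.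
- by move=> _; apply: sep.
- by move=> _ u v uA vB; rewrite eq_sym esym; apply: (sep A).
- exact: dM.
Qed.

End InducedMatchings.

(** * Degrees of nonvanishing homology in degenerate graphs *)

Section Regularity.
Variables (F : fieldType) (T : finType) (e : rel T).
Hypotheses (esym : symmetric e) (eirr : irreflexive e).
Implicit Types (S U Y : {set T}) (x y v : T) (m j k : nat).

Lemma redH_link_deletion S m v : v \in S -> redH_nonzero F e S m.+1 ->
  redH_nonzero F e (S :\ v) m.+1 ||
  redH_nonzero F e (S :\ v :\: [set u | e v u]) m.
Proof.
move=> vS; apply: contraLR; rewrite negb_or => /andP[/acyclicP acD /acyclicP acL].
by apply/acyclicP; apply: acyclic_link_deletion acD acL.
Qed.

Lemma redH_set0 m : redH_nonzero F e set0 m -> m = 0.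
Proof.
case: m => // m; have /acyclicP/negPf-> // : acyclic F e set0 m.+1.
move=> c cP _.
have c0 s : c s = 0%R.
  apply: chain0 cP _; apply/negP => /andP[/andP[]].
  by rewrite subset0 => /eqP-> _; rewrite cards0.
exists (fun=> 0%R) => s; first by rewrite eqxx.
by rewrite c0 /boundary big1 // => u _; rewrite mulr0.
Qed.

(** The vertices of [Y] are treated one at a time: a deletion keeps the degree, and a link lowers it
    by one while discarding at least one vertex of [Y]. *)
Lemma redH_remove S Y b m :
  (forall U j, U \subset S :\: Y -> redH_nonzero F e U j -> j <= b) ->
  redH_nonzero F e S m -> m <= b + #|Y :&: S|.
Proof.
have [n] := ubnP #|Y :&: S|; elim: n S m => // n IHn S m leY Ub nz.
case: m nz => [//|m] nz.
have [Y0|[y]] := set_0Vmem (Y :&: S).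
  rewrite Y0 cards0 addn0; apply: Ub nz.
  by rewrite subsetD subxx disjoint_sym -setI_eq0 Y0 /=.
rewrite inE => /andP[yY yS].
have [bD bL] : (forall U m', U \subset S :\ y -> redH_nonzero F e U m' ->
    m' <= b + #|Y :&: U|) /\ #|Y :&: (S :\ y)| < #|Y :&: S|.
  have ltY : #|Y :&: (S :\ y)| < #|Y :&: S|.
    rewrite setIDA [X in _ < X](cardsD1 y) inE yY yS add1n ltnS.
    by apply: subset_leq_card; apply/subsetP => z; rewrite !inE; case/and3P=> -> -> ->.
  split=> // U m' US; apply: IHn.
    apply: leq_ltn_trans (leq_trans ltY leY); apply: subset_leq_card.
    exact: setIS.
  move=> W j WU; apply: Ub; apply: subset_trans WU _.
  apply: setSD; apply: subset_trans US (subsetDl _ _).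
have [nzD|nzL] := orP (redH_link_deletion yS nz).
  by apply: leq_trans (bD _ _ (subxx _) nzD) _; rewrite leq_add2l ltnW.
have := bD _ _ (subsetDl _ _) nzL => /leq_ltn_trans; apply.
rewrite ltn_add2l; apply: leq_ltn_trans bL; apply: subset_leq_card.
by apply: setIS; apply: subsetDl.
Qed.

Definition degenerate k S : Prop :=
  forall U, U \subset S -> U != set0 ->
  exists2 x, x \in U & #|[set y in U | e x y]| <= k.

Lemma degenerate_sub k S U : U \subset S -> degenerate k S -> degenerate k U.
Proof. by move=> US dS W WU; apply: dS; apply: subset_trans US. Qed.

Lemma redH_degenerate k S m : degenerate k S -> redH_nonzero F e S m ->
  m <= k * im_in e S.
Proof.
have [n] := ubnP #|S|; elim: n S m => // n IHn S m leS dS nz.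
have [S0|S0] := eqVneq S set0.
  by move: nz; rewrite S0 => /redH_set0->.
have [x xS dx] := dS S (subxx S) S0.
set N := [set y in S | e x y] in dx.
have [N0|[y yN]] := set_0Vmem N.
  suff /acyclicP/negP : acyclic F e S m by [].
  apply: (acyclic_isolated (v := x)) => // u uS; apply/negP => exu.
  by have := in_set0 u; rewrite -N0 inE uS exu.
have [yS exy] : y \in S /\ e x y by move: yN; rewrite inE => /andP[].
case: m nz => // m nz.
have sub U : U \subset S :\ y -> [/\ #|U| < n, U \subset S & degenerate k U].
  move=> UD; have US : U \subset S by apply: subset_trans UD (subsetDl _ _).
  split=> //; last exact: degenerate_sub dS.
  apply: leq_trans (leS : #|S| <= n).
  by rewrite (cardsD1 y S) yS add1n ltnS subset_leq_card.
have [nzD|nzL] := orP (redH_link_deletion yS nz).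
  have [ltD DS dD] := sub _ (subxx (S :\ y)).
  apply: leq_trans (IHn _ _ ltD dD nzD) _.
  by rewrite leq_mul2l im_in_sub ?orbT.
(* Such a [U] misses the closed neighbourhoods of [x] and [y]; in particular [x] is gone as a
   neighbour of [y]. *)
have imU U : U \subset S :\ y :\: [set u | e y u] :\: N ->
    im_in e U < im_in e S.
  move=> UN; apply: (im_in_edge (x := x) (y := y)) => //.
    apply: subset_trans UN _; do 2 apply: subset_trans (subsetDl _ _) _.
    exact: subsetDl.
  move=> u /(subsetP UN); rewrite !inE => /and4P[nN nyu uy uS].
  rewrite uy nyu; move: nN; rewrite uS /= => ->; rewrite !andbT.
  by apply: contraNneq nyu => ->; rewrite esym.
(* The edge [xy] alone is an induced matching, so [.-1] below is a true predecessor. *)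
have i_gt0 : 0 < im_in e S by apply: leq_ltn_trans (imU set0 (sub0set _)).
have : m <= k * (im_in e S).-1 + #|N :&: (S :\ y :\: [set u | e y u])|.
  apply: redH_remove nzL => U j UN nzU.
  have [|ltU _ dU] := sub U.
    by apply: subset_trans UN _; apply: subset_trans (subsetDl _ _) (subsetDl _ _).
  apply: leq_trans (IHn _ _ ltU dU nzU) _.
  by rewrite leq_mul2l -ltnS prednK ?imU ?orbT.
move=> /leq_ltn_trans; apply; rewrite -{2}(prednK i_gt0) mulnS addnC ltn_add2r.
(* [y] is in [N] but not in its own link, so fewer than [k] neighbours of [x] remain; this pays for
   the degree lost to the link. *)
apply: leq_trans dx; apply: proper_card; apply/properP; split.
  exact: subsetIl.
by exists y; rewrite // !inE eqxx !andbF.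
Qed.

Lemma reg_leP b :
  (forall S m, redH_nonzero F e S m -> m <= b) -> reg F e <= b.
Proof.
move=> nzb; apply/bigmax_leqP => S _; apply/bigmax_leqP => m; exact: nzb.
Qed.

Lemma reg_degenerate k : degenerate k [set: T] -> reg F e <= k * im e.
Proof.
move=> dT; apply: reg_leP => S m nz.
apply: leq_trans (redH_degenerate (degenerate_sub (subsetT _) dT) nz) _.
by rewrite leq_mul2l im_in_im orbT.
Qed.

(** Both the deletion and the link of [x] avoid [x], and only the link costs a degree. *)
Lemma reg_degenerate_deletion k x : degenerate k [set~ x] ->
  reg F e <= (k * im e).+1.
Proof.
move=> dx; apply: reg_leP => S m nz.
have deg_nz U j : U \subset [set~ x] -> redH_nonzero F e U j -> j <= k * im e.
  move=> Ux /(redH_degenerate (degenerate_sub Ux dx))/leq_trans; apply.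
  by rewrite leq_mul2l im_in_im orbT.
have [xS|xS] := boolP (x \in S); last first.
  by apply: leqW (deg_nz _ _ _ nz); rewrite subsetC sub1set inE.
case: m nz => // m /(redH_link_deletion xS)/orP[|] /deg_nz Dx.
  by apply/leqW/Dx; rewrite setDE subsetIr.
by apply: Dx; rewrite subDset setDE subsetU // subsetIr orbT.
Qed.

(** * Degeneracy from degree bounds *)

(** A path from inside [U] to outside has a first edge leaving [U]. *)
Lemma leave_set U : connected e -> U != set0 -> U != [set: T] ->
  exists2 x, x \in U & exists2 y, y \notin U & e x y.
Proof.
move=> conn /set0Pn[u uU]; rewrite -subTset => /subsetPn[w _ wU].
have /connectP[p] := conn u w.
elim: p u uU => [|v p IHp] u uU /=; first by move=> _ wu; rewrite wu uU in wU.
case/andP=> euv vp wE; have [vU|vU] := boolP (v \in U); first exact: IHp vp wE.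
by exists u => //; exists v.
Qed.

(** An endpoint in [U] of an edge leaving [U] has lost one of its at most [k.+1] neighbours. *)
Lemma degenerate_connected k S : connected e -> (forall x, deg e x <= k.+1) ->
  S != [set: T] -> degenerate k S.
Proof.
move=> conn dk ST U US U0.
have UT : U != [set: T].
  by apply: contraNneq ST => UT; rewrite -subTset -UT.
have [x xU [y yU exy]] := leave_set conn U0 UT.
exists x => //; rewrite -ltnS; apply: leq_trans (dk x); apply: proper_card.
apply/properP; split; first by apply/subsetP => z; rewrite !inE => /andP[].
by exists y; rewrite !inE ?(negPf yU).
Qed.

Lemma deg_le_maxdeg x : deg e x <= maxdeg e.
Proof. exact: leq_bigmax. Qed.

Lemma mindeg_lt_maxdeg : mindeg e < maxdeg e -> exists x, deg e x < maxdeg e.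
Proof.
move=> lt; apply/existsP; apply: contraLR lt.
rewrite negb_exists -leqNgt => /forallP le; rewrite /mindeg.
elim/big_ind: _ => [|a b la lb|x _]; last by rewrite leqNgt.
  (* The start value [#|T|] of the minimum is also at least [maxdeg e]. *)
  by apply/bigmax_leqP => x _; apply: max_card.
by rewrite leq_min la.
Qed.

End Regularity.

Theorem mainTheorem11 (F : fieldType) (T : finType) (e : rel T) :
  simple_graph e -> connected e -> bipartite e ->
  ((mindeg e < maxdeg e <= 3)%N -> (reg F e <= 2 * im e)%N) /\
  (regular e 3 -> (reg F e <= 2 * im e + 1)%N).
Proof.
move=> [esym eirr] conn _; split=> [/andP[lt le3]|reg3].
  apply: reg_degenerate => // U _ U0; have [UT|UT] := eqVneq U [set: T].
    (* No edge leaves the whole vertex set; here a vertex of degree below the maximum, hence at most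
       2, serves instead. *)
    have [x dx] := mindeg_lt_maxdeg lt; exists x; first by rewrite UT inE.
    rewrite -ltnS (leq_trans _ le3) // (leq_ltn_trans _ dx) // subset_leq_card //.
    by apply/subsetP => y; rewrite !inE => /andP[].
  apply: (degenerate_connected conn _ UT) => // x.
  exact: leq_trans (deg_le_maxdeg e x) le3.
(* With no vertex to delete, degeneracy is vacuous. *)
rewrite addn1; have [T0|[x _]] := set_0Vmem [set: T].
  by apply: leqW; apply: reg_degenerate => // U _ /set0Pn[x]; have := in_setT x;
    rewrite T0 inE.
apply: (reg_degenerate_deletion _ esym eirr (x := x)).
apply: degenerate_connected => // [y|]; first by rewrite reg3.
by apply: contraTneq (in_setT x) => <-; rewrite !inE eqxx.
Qed.
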